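(* Let $n,p\in\mathbb{N}$ and $\epsilon>0$. For every $\epsilon$-differentially private algorithm which takes data sets of size $n$ with entries in $\{-\frac{1}{\sqrt p},\frac{1}{\sqrt p}\}^p$ and whose output, denoted $\theta^{priv}$, lies in the Euclidean unit ball $\mathbb{B}\subset\mathbb{R}^p$, there is a data set $\mathcal{D}=\{d_1,\dots,d_n\}\subseteq\{-\frac{1}{\sqrt p},\frac{1}{\sqrt p}\}^p$ such that, with probability at least $1/2$ over the algorithm's random coins, $$\mathcal{L}(\theta^{priv};\mathcal{D})-\mathcal{L}(\theta^*;\mathcal{D})=\Omega\left(\min\left(n,\frac{p}{\epsilon}\right)\right),$$ where $\mathcal{L}(\theta;\mathcal{D})=-\left\langle\theta,\sum_{i=1}^nd_i\right\rangle$ for $\theta\in\mathbb{B}$, and $\theta^*=\frac{\sum_{i=1}^nd_i}{\left\|\sum_{i=1}^nd_i\right\|_2}$ is the minimizer of $\mathcal{L}(\cdot;\mathcal{D})$ over $\mathbb{B}$.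
   Context: $\Omega(\cdot)$ hides an absolute positive multiplicative constant. Data sets are multisets (entries may repeat). Differential privacy: two data sets of size $n$ are neighbors if they differ in one entry. A randomized algorithm $\mathcal{A}$ is $\epsilon$-differentially private if for all neighboring $\mathcal{D},\mathcal{D}'$ and all events $S$ in the output space, $\Pr(\mathcal{A}(\mathcal{D})\in S)\le e^{\epsilon}\Pr(\mathcal{A}(\mathcal{D}')\in S)$.
   Formalization: Proved for p ≥ 2 and p/ε at least an absolute constant K. For p = 1, or p/ε below some absolute constant, the claim is false: randomized response (n = 1) or an exponential mechanism on the sums attains excess loss 0 with probability above 1/2 on every data set. *)

(* Defs.v *)
From HB Require Import structures.
From mathcomp Require Import all_boot all_order all_algebra finmap multiset.
From mathcomp Require Import all_classical all_reals all_analysis.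

Set Implicit Arguments.
Unset Strict Implicit.
Unset Printing Implicit Defensive.

Import Order.TTheory GRing.Theory Num.Theory.
Import numFieldNormedType.Exports.

Local Open Scope mset_scope.
Local Open Scope classical_set_scope.
Local Open Scope ring_scope.

Section Defs.
Variables (R : realType) (p : nat).
Local Notation V := 'rV[R]_p.

(* The library norm `|x| on row vectors is the sup norm, hence these. *)
Definition inner (x y : V) : R := \sum_(j < p) x 0 j * y 0 j.
Definition norm2 (x : V) : R := Num.sqrt (inner x x).

Definition unit_ball : set V := [set x | norm2 x <= 1].

Definition entry (x : V) : Prop :=
  forall j, x 0 j = - (Num.sqrt p%:R)^-1 \/ x 0 j = (Num.sqrt p%:R)^-1.

Definition dataset (n : nat) (D : {mset V}) : Prop :=
  size D = n /\ forall x, x \in D -> entry x.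

Definition neighbors (D D' : {mset V}) : Prop :=
  exists (E : {mset V}) (a b : V), D = (a +` E)%mset /\ D' = (b +` E)%mset.

Definition data_sum (D : {mset V}) : V := \sum_(x <- D) x.

Definition loss (theta : V) (D : {mset V}) : R := - inner theta (data_sum D).

(* When data_sum D = 0 this is 0, which is then also a minimizer. *)
Definition theta_star (D : {mset V}) : V :=
  (norm2 (data_sum D))^-1 *: data_sum D.

(* R^p with its Borel sigma-algebra (the topology of the sup norm is the
   Euclidean one). *)
Definition borelV := g_sigma_algebraType (@open V).

(* A randomized algorithm is a deterministic function of the data set and of
   the random coins w : T, drawn from the probability space (T, P).  Its values
   on multisets that are not data sets of size n are irrelevant. *)
Definition ball_algorithm (n : nat) (d : measure_display) (T : measurableType d)
    (A : {mset V} -> T -> V) : Prop :=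
  forall D, dataset n D ->
    measurable_fun [set: T] (A D : T -> borelV) /\
    forall w, unit_ball (A D w).

Definition private (n : nat) (eps : R) (d : measure_display)
    (T : measurableType d) (P : probability T R) (A : {mset V} -> T -> V) :
    Prop :=
  forall D D', dataset n D -> dataset n D' -> neighbors D D' ->
  forall S : set borelV, measurable S ->
    (P (A D @^-1` S) <= (expR eps)%:E * P (A D' @^-1` S))%E.

Lemma inner_ge0 (x : V) : 0 <= inner x x.
Proof. by apply: sumr_ge0 => j _; rewrite -expr2 sqr_ge0. Qed.

Lemma innerZr a (x y : V) : inner x (a *: y) = a * inner x y.
Proof.
by rewrite /inner mulr_sumr; apply: eq_bigr => j _; rewrite mxE mulrCA.
Qed.

Lemma innerC (x y : V) : inner x y = inner y x.
Proof. by apply: eq_bigr => j _; rewrite mulrC. Qed.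

Lemma innerB2 (x y : V) :
  inner (x - y) (x - y) = inner x x - inner x y *+ 2 + inner y y.
Proof.
rewrite /inner -sumrMnl -sumrB -big_split /=; apply: eq_bigr => j _.
by rewrite !mxE -!expr2 sqrrB.
Qed.

Lemma norm2_sqr (x : V) : norm2 x ^+ 2 = inner x x.
Proof. by rewrite sqr_sqrtr// inner_ge0. Qed.

Lemma norm2_eq0 (x : V) : norm2 x = 0 -> x = 0.
Proof.
move=> x0; have: inner x x = 0 by rewrite -norm2_sqr x0 expr0n.
move=> /eqP; rewrite psumr_eq0; last by move=> j _; rewrite -expr2 sqr_ge0.
move=> /allP h; apply/rowP => j; rewrite mxE.
by apply/eqP; have := h j (mem_index_enum j); rewrite /= mulf_eq0 orbb.
Qed.

Lemma norm2_theta_star (D : {mset V}) :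
  data_sum D != 0 -> norm2 (theta_star D) = 1.
Proof.
move=> D0; have n0 : norm2 (data_sum D) != 0.
  by apply: contra D0 => /eqP /norm2_eq0 ->.
rewrite /norm2 /theta_star innerZr innerC innerZr mulrA -norm2_sqr -expr2.
by rewrite -exprMn mulVf// expr1n sqrtr1.
Qed.

Lemma theta_star_in_ball (D : {mset V}) : unit_ball (theta_star D).
Proof.
rewrite /unit_ball /=; have [D0|D0] := eqVneq (data_sum D) 0.
  rewrite /theta_star D0 scaler0 /norm2 /inner big1 ?sqrtr0//.
  by move=> j _; rewrite mxE mul0r.
by rewrite norm2_theta_star.
Qed.

Lemma loss_theta_star (D : {mset V}) :
  loss (theta_star D) D = - norm2 (data_sum D).
Proof.
rewrite /loss innerC innerZr -norm2_sqr expr2.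
have [->|n0] := eqVneq (norm2 (data_sum D)) 0; first by rewrite !mulr0.
by rewrite mulKf.
Qed.

Lemma theta_star_min (D : {mset V}) (theta : V) :
  unit_ball theta -> loss (theta_star D) D <= loss theta D.
Proof.
move=> th1; rewrite loss_theta_star lerN2.
have N0 : 0 <= norm2 (data_sum D) by rewrite sqrtr_ge0.
move: N0; rewrite le_eqVlt => /orP[/eqP N0|N0].
  rewrite -N0 (norm2_eq0 (esym N0)) /inner big1// => j _.
  by rewrite mxE mulr0.
have tt1 : inner theta theta <= 1.
  by rewrite -norm2_sqr expr_le1// sqrtr_ge0.
have := inner_ge0 (theta - theta_star D).
rewrite innerB2 -(norm2_sqr (theta_star D)) norm2_theta_star; last first.
  apply: contraTneq N0 => ->; rewrite /norm2 /inner big1 ?sqrtr0 ?ltxx//.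
  by move=> j _; rewrite mxE mul0r.
rewrite expr1n /theta_star innerZr addrAC subr_ge0 => h.
have : (norm2 (data_sum D))^-1 * inner theta (data_sum D) *+ 2 <= 1 *+ 2.
  by apply: (le_trans h); rewrite mulr2n lerD2r.
by rewrite lerMn2r /= mulrC ler_pdivrMr// mul1r.
Qed.

Lemma theta_star_unique (D : {mset V}) (theta : V) : data_sum D != 0 ->
  unit_ball theta -> loss theta D <= loss (theta_star D) D ->
  theta = theta_star D.
Proof.
move=> D0 th1; rewrite loss_theta_star lerN2 => h.
have N0 : 0 < norm2 (data_sum D).
  rewrite lt_neqAle sqrtr_ge0 andbT eq_sym.
  by apply: contra D0 => /eqP /norm2_eq0 ->.
have tt1 : inner theta theta <= 1.
  by rewrite -norm2_sqr expr_le1// sqrtr_ge0.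
apply/eqP; rewrite -subr_eq0; apply/eqP/norm2_eq0.
apply/eqP; rewrite /norm2 sqrtr_eq0.
rewrite innerB2 -(norm2_sqr (theta_star D)) norm2_theta_star// expr1n.
rewrite /theta_star innerZr addrAC subr_le0.
apply: (@le_trans _ _ (1 *+ 2)); first by rewrite mulr2n lerD2r.
by rewrite lerMn2r /= mulrC ler_pdivlMr// mul1r.
Qed.

End Defs.

(* Main.v *)
(* For a sign vector v let D_v consist of m ~ min (n, p / eps) copies of v and
   of pairs of opposite entries, so that the excess loss of theta on D_v is
   m (1 - <theta, v>).  If the output were accurate on every D_v, then by group
   privacy its law on one fixed D_w would give each cap <theta, v> > 39/40 mass
   at least e^(- m eps) / 2.  Averaged over all 2^p sign vectors v this is
   absurd: a point of the ball lies in at most 1.33^p of these caps, since any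
   two sign vectors with a common theta in their caps have inner product at
   least 9/10, and an exponential moment bounds the number of those. *)
Require Import Defs.
From HB Require Import structures.
From mathcomp Require Import all_boot all_order all_algebra finmap multiset.
From mathcomp Require Import all_classical all_reals all_analysis.
From mathcomp Require Import measurable_realfun ring lra zify.
Import Order.TTheory GRing.Theory Num.Theory.
Import numFieldNormedType.Exports.
Local Open Scope mset_scope.
Local Open Scope classical_set_scope.
Local Open Scope ring_scope.

Set Implicit Arguments.
Unset Strict Implicit.
Unset Printing Implicit Defensive.

(** * Inner products against points of the ball, and half-spaces *)

Section Inner.
Context {R : realType} {p : nat}.
Implicit Types x y z : 'rV[R]_p.

Lemma innerDr x y z : inner x (y + z) = inner x y + inner x z.
Proof.
by rewrite /inner -big_split; apply: eq_bigr => j _ /=; rewrite mxE mulrDr.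
Qed.

Lemma inner_le1 x : unit_ball x -> inner x x <= 1.
Proof. by move=> x1; rewrite -norm2_sqr expr_le1// sqrtr_ge0. Qed.

(* Expand [0 <= |y + z - 2 x|^2]. *)
Lemma inner_cap x y z : inner x x <= 1 -> inner y y = 1 -> inner z z = 1 ->
  4 * (inner x y + inner x z) - 6 <= 2 * inner y z.
Proof.
move=> xx yy zz; have := inner_ge0 (y + z - 2 *: x).
rewrite innerB2 !innerZr (innerC (_ *: _) x) innerZr innerDr.
rewrite (innerC (y + z) x) !innerDr !(innerC (y + z)) !innerDr yy zz.
rewrite (innerC z y) -mulr_natr; lra.
Qed.

Lemma continuous_innerl y : continuous (fun x : 'rV[R]_p => inner x y).
Proof.
apply: continuous_big => [|j _ x]; first exact: add_continuous.
apply: (@continuousM _ _ (fun z : 'rV[R]_p => z 0 j) (fun=> y 0 j)).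
  exact: coord_continuous.
exact: cst_continuous.
Qed.

Lemma measurable_halfspace y (t : R) :
  measurable ([set x | t < inner x y] : set (borelV R p)).
Proof.
apply: sub_sigma_algebra.
rewrite (_ : mkset _ = (fun x => inner x y) @^-1` [set u | t < u])//.
by apply: open_comp => [? _|]; [exact: continuous_innerl|exact: open_gt].
Qed.

End Inner.

(** * Sign vectors, and how many of their caps can share a point *)

Section SignVectors.
Context {R : realType} {p : nat}.
Hypothesis p_gt0 : (0 < p)%N.
Implicit Types b : {ffun 'I_p -> bool}.

Definition sign_vec b : 'rV[R]_p :=
  \row_j (if b j then (Num.sqrt p%:R)^-1 else - (Num.sqrt p%:R)^-1).

Lemma entry_sign_vec b : entry (sign_vec b).
Proof. by move=> j; rewrite mxE; case: ifP; [right|left]. Qed.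

Lemma entry_opp (x : 'rV[R]_p) : entry x -> entry (- x).
Proof.
by move=> ex j; rewrite mxE; case: (ex j) => ->; [right; rewrite opprK|left].
Qed.

Lemma inner_sign_vec b c :
  p%:R * inner (sign_vec b) (sign_vec c) =
  \sum_j (if b j == c j then 1 else -1).
Proof.
have p0 : 0 < p%:R :> R by rewrite ltr0n.
have s0 : Num.sqrt p%:R != 0 :> R by rewrite gt_eqF// sqrtr_gt0.
rewrite /inner mulr_sumr; apply: eq_bigr => j _; rewrite !mxE.
rewrite -[X in X * _]sqr_sqrtr ?ler0n//.
by case: (b j) (c j) => -[] /=; field.
Qed.

Lemma inner_sign_vec1 b : inner (sign_vec b) (sign_vec b) = 1.
Proof.
have p0 : p%:R != 0 :> R by rewrite pnatr_eq0 -lt0n.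
apply: (mulfI p0); rewrite inner_sign_vec mulr1.
under eq_bigr do rewrite eqxx.
by rewrite sumr_const card_ord.
Qed.

(** Exponential moment bound: each indicator is at most [expR (p * (inner - s))]. As [p * inner] is
    a sum of signs, one per coordinate, this exponential factors over the coordinates, and the sum
    over all [b] becomes a product of two-term sums. *)
Lemma sum_correlated_sign_vec (s : R) c :
  \sum_b (s <= inner (sign_vec b) (sign_vec c))%R%:R <=
  (expR (1 - s) + expR (- 1 - s)) ^+ p.
Proof.
pose F (j : 'I_p) (e : bool) : R :=
  if e == c j then expR (1 - s) else expR (- 1 - s).
have -> : (expR (1 - s) + expR (- 1 - s)) ^+ p = \prod_(j < p) \sum_e F j e.
  rewrite -[p in LHS]card_ord -prodr_const; apply: eq_bigr => j _.
  by rewrite big_bool /F; case: (c j) => //=; rewrite addrC.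
rewrite bigA_distr_bigA; apply: ler_sum => b _.
have -> : \prod_j F j (b j) =
    expR (p%:R * (inner (sign_vec b) (sign_vec c) - s)).
  rewrite mulrBr inner_sign_vec -[p in p%:R]card_ord.
  rewrite -sum1_card natr_sum mulr_suml -sumrB expR_sum.
  by apply: eq_bigr => j _; rewrite /F mul1r; case: ifP.
case: (leP s _) => [h|_]; last by rewrite mulr0n expR_ge0.
by rewrite mulr1n -expR0 ler_expR mulr_ge0// subr_ge0.
Qed.

Lemma sign_vec_cap (x : 'rV[R]_p) : unit_ball x ->
  \sum_b (39 / 40 < inner x (sign_vec b))%R%:R <= (133 / 100) ^+ p :> R.
Proof.
move=> /inner_le1 x1.
have [/existsP[c xc]|nocap] :=
    boolP [exists b, 39 / 40 < inner x (sign_vec b)]; last first.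
  rewrite big1 => [|b _]; first by rewrite exprn_ge0//; lra.
  by rewrite (negbTE (existsPn nocap b)).
(* Any other cap containing [x] has its center correlated with [c]: [inner_cap] gives 4 * (39/40 +
   39/40) - 6 = 2 * (9/10). *)
apply: (@le_trans _ _
    (\sum_b (9 / 10 <= inner (sign_vec b) (sign_vec c))%R%:R)).
  apply: ler_sum => b _; rewrite ler_nat.
  case: ltP => // xb; case: (leP (9 / 10)) => //.
  have := inner_cap x1 (inner_sign_vec1 b) (inner_sign_vec1 c).
  lra.
apply: (le_trans (sum_correlated_sign_vec _ c)).
apply: lerXn2r; rewrite ?nnegrE ?addr_ge0 ?expR_ge0//.
(* Both exponentials are bounded through [1 + t <= expR t], at t = -1/10 here and at t = 19/40,
   raised to the fourth power, in [e2]. The target is 10/9 + 7/32 < 133/100. *)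
have e1 : expR (1 - 9 / 10) <= 10 / 9 :> R.
  have := @expR_ge1Dx R (- (1 - 9 / 10)).
  rewrite expRN -[expR (1 - _)]invrK -[10 / 9]invrK => h.
  by rewrite lef_pV2 ?posrE ?invr_gt0 ?expR_gt0//; lra.
have e2 : expR (- 1 - 9 / 10) <= 7 / 32 :> R.
  have -> : - 1 - 9 / 10 = - (19 / 40) * 4%:R :> R by lra.
  rewrite expRM_natr expRN exprVn -[7 / 32]invrK.
  rewrite lef_pV2 ?posrE ?exprn_gt0 ?invr_gt0 ?expR_gt0//.
  apply: (@le_trans _ _ ((59 / 40) ^+ 4)); first by rewrite !exprS expr0; lra.
  have := @expR_ge1Dx R (19 / 40).
  by move=> h; apply: lerXn2r; rewrite ?nnegrE ?expR_ge0//; lra.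
lra.
Qed.

End SignVectors.

(** * Overlapping events and the sum of their probabilities *)

Section Measure.
Context {R : realType} {d : measure_display} {T : measurableType d}.
Variable P : probability T R.

(* Integrate the number of events that occur. *)
Lemma sum_probability_le (I : finType) (E : I -> set T) (B : R) :
  (forall i, measurable (E i)) ->
  (forall w, \sum_i \1_(E i) w <= B) -> (\sum_i P (E i) <= B%:E)%E.
Proof.
move=> mE EB.
under eq_bigr => i _.
  rewrite -[E i]setIT -(integral_indic P measurableT (mE i)).
  over.
rewrite -ge0_integral_sum//; last first.
  by move=> i; apply/measurable_EFinP; exact: measurable_indic.
have <- : (\int[P]_(w in [set: T]) cst B%:E w = B%:E)%E.
  by rewrite integral_cst// -[RHS]mule1 -(@probability_setT _ _ _ P).
apply: ge0_le_integral => //.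
- by move=> w _; apply: sume_ge0 => i _; rewrite lee_fin.
- apply: emeasurable_sum => i.
  by apply/measurable_EFinP; exact: measurable_indic.
- by move=> w _; rewrite sumEFin lee_fin EB.
Qed.

End Measure.

(** * Data sets given by sequences, and group privacy *)

Section SeqDatasets.
Context {R : realType} {p : nat}.
Implicit Types (l : seq 'rV[R]_p) (u v : 'rV[R]_p).

Lemma dataset_seq_mset n l :
  size l = n -> (forall x, x \in l -> entry x) -> dataset n (seq_mset l).
Proof.
move=> sl el; split; first by rewrite -sl (perm_size (perm_eq_seq_mset l)).
by move=> x; rewrite (perm_mem (perm_eq_seq_mset l)) => /el.
Qed.

Lemma data_sum_seq_mset l : data_sum (seq_mset l) = \sum_(x <- l) x.
Proof. exact/perm_big/perm_eq_seq_mset. Qed.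

(** The copies are exchanged one at a time, each exchange costing a factor [expR eps]. The induction
    generalizes [l] so that the copy of [u] not yet exchanged can wait there. *)
Lemma group_privacy n eps d (T : measurableType d) (P : probability T R) A m u v
    l (S : set (borelV R p)) :
  private n eps P A -> measurable S ->
  (m + size l)%N = n -> entry u -> entry v -> (forall x, x \in l -> entry x) ->
  (P (A (seq_mset (nseq m u ++ l)) @^-1` S) <=
   (expR (m%:R * eps))%:E * P (A (seq_mset (nseq m v ++ l)) @^-1` S))%E.
Proof.
move=> privA mS + eu ev; elim: m => [|m IH] in l *.
  by rewrite mul0r expR0 mul1e.
move=> sl el.
have eul x : x \in u :: l -> entry x by rewrite inE => /predU1P[->//|/el].
have en k w x : entry w -> x \in nseq k w ++ l -> entry x.
  by move=> ew; rewrite mem_cat mem_nseq => /orP[/andP[_ /eqP->]|/el].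
have cons_move w :
    seq_mset (nseq m w ++ u :: l) = seq_mset (u :: nseq m w ++ l).
  exact/eq_seq_msetP/permPl/(perm_catCA _ [:: u]).
rewrite [nseq m.+1 u ++ l]/= -cons_move.
apply: (le_trans (IH (u :: l) _ _)) => //=; first by rewrite addnS.
rewrite cons_move -natr1 mulrDl mul1r expRD EFinM -muleA.
apply: lee_wpmul2l; first by rewrite lee_fin expR_ge0.
apply: privA => //.
- apply: dataset_seq_mset; first by rewrite /= size_cat size_nseq.
  by move=> x; rewrite inE => /predU1P[->//|]; exact: en.
- apply: dataset_seq_mset; first by rewrite /= size_cat size_nseq.
  by move=> x; rewrite inE => /predU1P[->//|]; exact: en.
- by exists (seq_mset (nseq m v ++ l)), u, v; rewrite !mset_cons.
Qed.

End SeqDatasets.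

(** * The hard data sets and the counting contradiction *)

Section LowerBound.
Context {R : realType} {n p m q : nat} {eps : R}.
Hypotheses (p_gt1 : (1 < p)%N) (m_gt0 : (0 < m)%N) (nmq : n = (m + q.*2)%N).
Hypothesis m_le : m%:R * eps <= p%:R / 20.

Let padding : seq 'rV[R]_p :=
  let u := sign_vec [ffun=> true] in nseq q u ++ nseq q (- u).

Let hard_data (b : {ffun 'I_p -> bool}) : {mset 'rV[R]_p} :=
  seq_mset (nseq m (sign_vec b) ++ padding).

Lemma entry_padding x : x \in padding -> entry x.
Proof.
rewrite mem_cat !mem_nseq => /orP[] /andP[_ /eqP->].
  exact: entry_sign_vec.
exact/entry_opp/entry_sign_vec.
Qed.

Lemma size_padding : size padding = q.*2.
Proof. by rewrite size_cat !size_nseq addnn. Qed.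

Lemma dataset_hard_data b : dataset n (hard_data b).
Proof.
apply: dataset_seq_mset; first by rewrite size_cat size_nseq size_padding.
move=> x; rewrite mem_cat => /orP[|/entry_padding//].
by rewrite mem_nseq => /andP[_ /eqP->]; exact: entry_sign_vec.
Qed.

Lemma data_sum_hard_data b : data_sum (hard_data b) = m%:R *: sign_vec b.
Proof.
rewrite data_sum_seq_mset !big_cat /= !big_nseq !iter_addr !addr0.
by rewrite mulNrn subrr addr0 scaler_nat.
Qed.

Lemma excess_hard_data b x :
  loss x (hard_data b) - loss (theta_star (hard_data b)) (hard_data b) =
  m%:R * (1 - inner x (sign_vec b)).
Proof.
rewrite loss_theta_star /loss /norm2 data_sum_hard_data !innerZr.
rewrite (innerC (_ *: _)) innerZr inner_sign_vec1 ?(ltnW p_gt1)// mulr1 -expr2.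
by rewrite sqrtr_sqr ger0_norm//; ring.
Qed.

Lemma private_excess d (T : measurableType d) (P : probability T R)
    (A : {mset 'rV[R]_p} -> T -> 'rV[R]_p) (e : R) :
  ball_algorithm n A -> private n eps P A -> e <= m%:R / 40 ->
  exists D, dataset n D /\
    ((2^-1 : R)%:E <=
     P [set w | (e <= loss (A D w) D - loss (theta_star D) D)%R])%E.
Proof.
move=> ballA privA e_le; apply: contrapT => noD.
pose b0 : {ffun 'I_p -> bool} := [ffun=> true].
pose G (b : {ffun 'I_p -> bool}) : set (borelV R p) :=
  [set x | 39 / 40 < inner x (sign_vec b)].
have m0 : 0 < m%:R :> R by rewrite ltr0n.
have mA b : measurable_fun [set: T] (A (hard_data b) : T -> borelV R p).
  by have [] := ballA _ (dataset_hard_data b).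
have mAS b (S : set (borelV R p)) :
    measurable S -> measurable (A (hard_data b) @^-1` S).
  by move=> mS; rewrite -[X in measurable X]setTI; exact: mA.
have half b : ((2^-1 : R)%:E <= P (A (hard_data b) @^-1` G b))%E.
  rewrite leNgt; apply/negP => lt_half; apply: noD; exists (hard_data b).
  split; first exact: dataset_hard_data.
  (* [H] is the set of outputs with excess loss below [e]; it lies in [G b] because e / m <=
     1/40. *)
  pose H : set (borelV R p) := [set x | 1 - e / m%:R < inner x (sign_vec b)].
  have mH : measurable (A (hard_data b) @^-1` H).
    by apply: mAS; exact: measurable_halfspace.
  rewrite (_ : mkset _ = ~` (A (hard_data b) @^-1` H)); last first.
    apply/seteqP; split=> w /=; rewrite excess_hard_data /H /=.
      move=> ew; apply/negP; rewrite -leNgt lerBrDr -lerBrDl.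
      by rewrite ler_pdivrMr// mulrC.
    by move/negP; rewrite -leNgt lerBrDr -lerBrDl ler_pdivrMr// mulrC.
  rewrite probability_setC// leeBrDr//; last first.
    by rewrite fin_num_measure.
  have : (P (A (hard_data b) @^-1` H) <= (2^-1 : R)%:E)%E.
    apply: le_trans (ltW lt_half); apply: le_measure; rewrite ?inE//.
      by apply: mAS; exact: measurable_halfspace.
    move=> w; rewrite /H /G /=; apply: le_lt_trans.
    have : e / m%:R <= 1 / 40 by rewrite ler_pdivrMr//; lra.
    lra.
  move=> h; apply: (@le_trans _ _ ((2^-1 : R)%:E + (2^-1 : R)%:E)%E).
    exact: leeD2l.
  by rewrite -EFinD lee_fin; lra.
have capE b : (((19 / 20) ^+ p / 2)%:E <= P (A (hard_data b0) @^-1` G b))%E.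
  have mG : measurable (G b) by exact: measurable_halfspace.
  have := le_trans (half b) (group_privacy privA mG _ _ _ (@entry_padding)).
  move=> /(_ (sign_vec b0)); rewrite size_padding => /(_ (esym nmq)).
  move=> /(_ (entry_sign_vec _) (entry_sign_vec _)).
  rewrite -/(hard_data b0) -[P _]fineK ?fin_num_measure//; last exact: mAS.
  rewrite -EFinM !lee_fin; set r := fine _ => half_le.
  have e0 := expR_gt0 (m%:R * eps).
  rewrite -ler_pdivrMl// in half_le; apply: le_trans half_le.
  rewrite ler_pM2r ?invr_gt0// -expRN.
  (* The privacy loss satisfies m * eps <= p / 20, and [expR (- (1 / 20))] is at least 19/20. *)
  apply: (@le_trans _ _ (expR (- (1 / 20)) ^+ p)).
    apply: lerXn2r; rewrite ?nnegrE ?expR_ge0//.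
    by have := @expR_ge1Dx R (- (1 / 20)); lra.
  rewrite -expRM_natr ler_expR mulNr lerN2 (le_trans m_le)//; lra.
have := @sum_probability_le _ _ _ P _ (fun b => A (hard_data b0) @^-1` G b)
  ((133 / 100) ^+ p) (fun b => mAS b0 _ (measurable_halfspace _ _)).
have capB w : \sum_b \1_(A (hard_data b0) @^-1` G b) w <= (133 / 100) ^+ p :> R.
  have [_ /(_ w) Aw1] := ballA _ (dataset_hard_data b0).
  apply: le_trans (sign_vec_cap (ltnW p_gt1) Aw1); apply: ler_sum => b _.
  by rewrite indicE mem_setE.
move=> /(_ capB); rewrite leNgt => /negP; apply.
apply: (@lt_le_trans _ _ (\sum_b ((19 / 20) ^+ p / 2)%:E)%E); last first.
  by apply: lee_sum => b _; exact: capE.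
rewrite sumEFin lte_fin sumr_const card_ffun card_bool card_ord.
rewrite -[X in _ < X]mulr_natr natrX.
(* The ratio of the two bounds is (10/7)^p / 2, since 2 * 19/20 = 133/100 * 10/7. It exceeds 1 once
   p >= 2, because (10/7)^2 = 100/49. *)
have -> : (19 / 20) ^+ p / 2 * 2 ^+ p =
    (133 / 100) ^+ p * ((10 / 7) ^+ p / 2) :> R.
  rewrite mulrAC -exprMn mulrA -exprMn; congr (_ ^+ p / _); lra.
rewrite ltr_pMr ?exprn_gt0// ltr_pdivlMr// mul1r.
apply: (@lt_le_trans _ _ ((10 / 7) ^+ 2)); first by rewrite expr2; lra.
by apply: ler_weXn2l => //; lra.
Qed.

End LowerBound.

(* [m] copies of the hard vector, with [n - m] even so that the remaining
   entries can cancel in pairs. *)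
Lemma exists_multiplicity {R : realType} (n : nat) (x : R) :
  (0 < n)%N -> 2 <= x ->
  exists m q : nat,
    [/\ (0 < m)%N, n = (m + q.*2)%N, m%:R <= x & Num.min n%:R x <= 3 * m%:R].
Proof.
move=> n0 x2; have [nx|xn] := leP n%:R x.
  exists n, 0%N; split=> //; first by rewrite addn0.
  have : 0 <= n%:R :> R by rewrite ler0n.
  lra.
have x0 : 0 <= x by lra.
have /andP[kx xk] := truncn_itv x0; set k := Num.trunc x in kx xk.
have k2 : (2 <= k)%N by rewrite truncn_ge_nat.
have kn : (k <= n)%N by rewrite -(ler_nat R); lra.
have bound m : (k.+1 <= 3 * m)%N -> x <= 3 * m%:R.
  by move=> km; rewrite (le_trans (ltW xk))// -natrM ler_nat.
(* Dropping to k - 1 repairs the parity. With k >= 2 this stays positive and k + 1 <= 3 * (k - 1),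
   whence the factor 3. *)
have [odd_nk|even_nk] := boolP (odd (n - k)).
  exists k.-1, (n - k.-1)./2; split; [lia|lia| |apply: bound; lia].
  by rewrite (le_trans _ kx)// ler_nat; lia.
by exists k, (n - k)./2; split; [lia|lia| |apply: bound; lia].
Qed.

(* Omega is read asymptotically: an absolute multiplicative constant c, and an
   absolute threshold K on p / eps.  The restrictions 1 < p and K <= p / eps
   cannot be dropped: for p = 1, or n = 1 and eps >> p, randomized response
   attains excess loss 0 with probability > 1/2 on every data set. *)
Theorem theorem5p2 (R : realType) :
  exists c K : R, 0 < c /\ 0 < K /\
  forall (n p : nat) (eps : R),
    (0 < n)%N -> (1 < p)%N -> 0 < eps -> K <= p%:R / eps ->
  forall (d : measure_display) (T : measurableType d) (P : probability T R)
         (A : {mset 'rV[R]_p} -> T -> 'rV[R]_p),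
    ball_algorithm n A ->
    private n eps P A ->
  exists D : {mset 'rV[R]_p},
    dataset n D /\
    ((2^-1 : R)%:E <=
     P [set w | (c * Num.min n%:R (p%:R / eps) <=
                 loss (A D w) D - loss (theta_star D) D)%R])%E.
Proof.
(* The multiplicity is chosen for x = p / eps / 20, so that m * eps <= p / 20; x >= 2 asks for p /
   eps >= 40. The losses 20 from this scaling, 3 from the multiplicity and 40 from the cap width
   multiply to 2400. *)
exists (1 / 2400), 40; split; first lra; split; first lra.
move=> n p eps n0 p1 eps0 K_le d T P A ballA privA.
have [m [q [m0 nmq m_le min_le]]] :=
  @exists_multiplicity R n (p%:R / eps / 20) n0 ltac:(lra).
apply: (private_excess p1 m0 nmq _ ballA privA).
  by move: m_le; rewrite mulrAC ler_pdivlMr.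
have : Num.min n%:R (p%:R / eps) <= 20 * Num.min n%:R (p%:R / eps / 20).
  have : 0 <= n%:R :> R by rewrite ler0n.
  rewrite !minEle; do 2 case: ifP; lra.
lra.
Qed.
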